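(* Let $\mathbb{H}=\{\tau\in\mathbb{C}:\operatorname{Im}\tau>0\}$ and let $f:\mathbb{H}\to\mathbb{H}$ be any function. Then for all $\tau\in\mathbb{H}$ and $x\in\mathbb{C}$: (1) $$2\theta\left(\tfrac{f(\tau)-\tau}{4}+x,\tau\right)-2\theta\left(\tfrac{f(\tau)-\tau}{8}+\tfrac{x+1}{2},\tfrac{\tau}{4}\right)=e^{\pi i\left(\frac{f(\tau)}{4}+x\right)}\theta\left(\tfrac{f(\tau)+\tau}{4}+x,\tau\right)+e^{\pi i\left(\frac{2\tau-f(\tau)}{4}-x\right)}\theta\left(\tfrac{f(\tau)-3\tau}{4}+x,\tau\right);$$ (2) $$\frac{2\sqrt3}{1+\sqrt3}\theta\left(\tfrac{f(\tau)-\tau}{6}+x,\tau\right)-\sqrt3\left[e^{\frac{\pi i}{3}\left(\frac{f(\tau)}{3}+2x\right)}\theta\left(\tfrac{f(\tau)+\tau}{6}+x,\tau\right)+e^{\frac{\pi i}{3}\left(\frac{2\tau-f(\tau)}{3}-2x\right)}\theta\left(\tfrac{f(\tau)-3\tau}{6}+x,\tau\right)\right]$$ $$=\theta\left(\tfrac{f(\tau)-\tau}{18}+\tfrac{x+1}{3},\tfrac{\tau}{9}\right)+\theta\left(\tfrac{f(\tau)-\tau}{18}+\tfrac{x-1}{3},\tfrac{\tau}{9}\right)-\frac{2}{1+\sqrt3}\theta\left(\tfrac{f(\tau)-\tau}{18}+\tfrac{x}{3},\tfrac{\tau}{9}\right).$$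
   Context: $\theta$ is the Jacobi theta function $\theta(z,\tau)=\sum_{m\in\mathbb{Z}}e^{\pi i m^2\tau}e^{2\pi i m z}$ for $z\in\mathbb{C}$, $\operatorname{Im}\tau>0$. *)

(* Defs.v *)
(* Stdlib reals with Coquelicot's complex numbers. *)
From Stdlib Require Import Reals ZArith Lra.
From Coquelicot Require Import Coquelicot.

Local Open Scope R_scope.

Definition UHP : Type := {tau : C | 0 < Im tau}.

Definition UHP_val (t : UHP) : C := proj1_sig t.
Coercion UHP_val : UHP >-> C.

Definition Cexp (z : C) : C :=
  (exp (Re z) * cos (Im z), exp (Re z) * sin (Im z)).

(* Coquelicot's total operator [Series] is real-valued only; a complex series
   is summed componentwise (see [CSeries_unique]). *)
Definition CSeries (a : nat -> C) : C :=
  (Series (fun n => Re (a n)), Series (fun n => Im (a n))).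

(* Sum over all of [Z]: the terms m >= 0, then the terms m <= -1. *)
Definition ZSeries (a : Z -> C) : C :=
  (CSeries (fun n => a (Z.of_nat n))
   + CSeries (fun n => a (- Z.of_nat (S n))%Z))%C.

Definition theta_term (z tau : C) (m : Z) : C :=
  (Cexp (PI * Ci * IZR m ^ 2 * tau) * Cexp (2 * PI * Ci * IZR m * z))%C.

(* Meaningful for [0 < Im tau], where the series converges absolutely
   (see [theta_abs_cv]). *)
Definition theta (z tau : C) : C := ZSeries (theta_term z tau).

Lemma CSeries_unique (a : nat -> C) (l : C) :
  is_series a l -> CSeries a = l.
Proof.
intros H.
assert (Hsum : forall n, sum_n a n =
  (sum_n (fun k => Re (a k)) n, sum_n (fun k => Im (a k)) n)).
{ induction n as [|n IH].
  - rewrite !sum_O. destruct (a 0%nat); reflexivity.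
  - rewrite !sum_Sn, IH. destruct (a (S n)); reflexivity. }
assert (Hr : is_series (fun n => Re (a n)) (Re l)).
{ intros P [e He]. destruct (H (fun y : C => P (Re y))) as [N HN].
  - exists e. intros y [Hy _]. apply He, Hy.
  - exists N. intros n Hn. specialize (HN n Hn). rewrite Hsum in HN. exact HN. }
assert (Hi : is_series (fun n => Im (a n)) (Im l)).
{ intros P [e He]. destruct (H (fun y : C => P (Im y))) as [N HN].
  - exists e. intros y [_ Hy]. apply He, Hy.
  - exists N. intros n Hn. specialize (HN n Hn). rewrite Hsum in HN. exact HN. }
unfold CSeries. rewrite (is_series_unique _ _ Hr), (is_series_unique _ _ Hi).
destruct l; reflexivity.
Qed.

Lemma Cmod_Cexp (z : C) : Cmod (Cexp z) = exp (Re z).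
Proof.
unfold Cmod, Cexp; simpl fst; simpl snd.
replace ((exp (Re z) * cos (Im z)) ^ 2 + (exp (Re z) * sin (Im z)) ^ 2)
  with (exp (Re z) * exp (Re z) * (Rsqr (sin (Im z)) + Rsqr (cos (Im z))))
  by (unfold Rsqr; ring).
rewrite sin2_cos2, Rmult_1_r.
apply sqrt_square, Rlt_le, exp_pos.
Qed.

Lemma theta_term_bound (z tau : C) : 0 < Im tau ->
  exists K : R, forall m : Z,
    Cmod (theta_term z tau m) <= K * exp (- Rabs (IZR m)).
Proof.
intros Ht.
set (b := 2 * PI * Rabs (Im z) + 1).
exists (exp (b ^ 2 / (4 * (PI * Im tau)))). intros m.
assert (HP := PI_RGT_0).
assert (Hy : 0 < PI * Im tau) by nra.
unfold theta_term. rewrite Cmod_mult, !Cmod_Cexp, <- !exp_plus.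
replace (Re (PI * Ci * IZR m ^ 2 * tau)) with (- (PI * Im tau * IZR m ^ 2))
  by (destruct tau; simpl; ring).
replace (Re (2 * PI * Ci * IZR m * z)) with (- (2 * PI * (IZR m * Im z)))
  by (destruct z; simpl; ring).
assert (H1 : - (IZR m * Im z) <= Rabs (IZR m) * Rabs (Im z)).
{ rewrite <- Rabs_mult, <- Rabs_Ropp. apply Rle_abs. }
rewrite <- (pow2_abs (IZR m)).
set (r := Rabs (IZR m)) in *.
assert (H2 : b * r - PI * Im tau * r ^ 2 <= b ^ 2 / (4 * (PI * Im tau))).
{ apply Rmult_le_reg_r with (4 * (PI * Im tau)); [lra|].
  replace (b ^ 2 / (4 * (PI * Im tau)) * (4 * (PI * Im tau))) with (b ^ 2)
    by (field; split; nra).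
  assert (0 <= (b - 2 * (PI * Im tau) * r) ^ 2) by apply pow2_ge_0. nra. }
assert (Hexp : - (PI * Im tau * r ^ 2) + - (2 * PI * (IZR m * Im z))
               <= b ^ 2 / (4 * (PI * Im tau)) + - r).
{ unfold b in *. nra. }
destruct Hexp as [Hlt | Heq]; [left; now apply exp_increasing | right; now rewrite Heq].
Qed.

Lemma ex_series_exp_opp : ex_series (fun n => exp (- INR n)).
Proof.
apply ex_series_ext with (fun n => exp (-1) ^ n).
- induction n as [|n IH]; [now simpl; rewrite Ropp_0, exp_0|].
  rewrite S_INR, Ropp_plus_distr, exp_plus, <- IH; simpl.
  replace (- (1)) with (-1) by lra. ring.
- apply ex_series_geom. rewrite Rabs_pos_eq by (apply Rlt_le, exp_pos).
  rewrite <- exp_0. apply exp_increasing. lra.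
Qed.

Lemma theta_abs_cv (z tau : C) : 0 < Im tau ->
  ex_series (fun n => Cmod (theta_term z tau (Z.of_nat n))) /\
  ex_series (fun n => Cmod (theta_term z tau (- Z.of_nat (S n))%Z)).
Proof.
intros Ht. destruct (theta_term_bound z tau Ht) as [K HK].
assert (Hn : forall n, Rabs (IZR (Z.of_nat n)) = INR n)
  by (intros n; rewrite <- INR_IZR_INZ; apply Rabs_pos_eq, pos_INR).
split.
- apply (@ex_series_le R_AbsRing R_CompleteNormedModule _
           (fun n => K * exp (- INR n))).
  + intros n. change norm with Rabs. rewrite Rabs_pos_eq by apply Cmod_ge_0.
    rewrite <- Hn. apply HK.
  + apply (ex_series_scal_l K (fun n => exp (- INR n))), ex_series_exp_opp.
- apply (@ex_series_le R_AbsRing R_CompleteNormedModule _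
           (fun n => K * exp (- INR (S n)))).
  + intros n. change norm with Rabs. rewrite Rabs_pos_eq by apply Cmod_ge_0.
    rewrite <- Hn, <- (Rabs_Ropp (IZR (Z.of_nat (S n)))), <- opp_IZR. apply HK.
  + apply (ex_series_scal_l K (fun n => exp (- INR (S n)))).
    apply (ex_series_incr_1 (fun n => exp (- INR n))), ex_series_exp_opp.
Qed.

(* Main.v *)
(* Splitting the sum defining theta (z, tau) by the residue r of the summation
   index modulo d gives
     theta (z, tau) = sum_(r < d) e^(pi i r^2 tau + 2 pi i r z)
                                  theta (d (z + r tau), d^2 tau).
   Identity (1) is the case d = 2. For (2), d = 3 is applied to the arguments
   (z + j) / 3 with j = 1, -1, 0, the coefficients being cube roots of unity;
   the residue class r = 2 is turned into r = -1 by quasi-periodicity. *)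
Require Import Defs.
From Stdlib Require Import Reals ZArith Lra Lia.
From Coquelicot Require Import Coquelicot.

Open Scope C_scope.

(** * Regrouping sums and series into blocks of equal length *)

Lemma sum_n_rev {G : AbelianMonoid} (f : nat -> G) (n : nat) :
  sum_n (fun k => f (n - k)%nat) n = sum_n f n.
Proof.
induction n as [|n IH]; [now rewrite !sum_O|].
rewrite (sum_Sn f), <- IH, plus_comm. unfold sum_n.
rewrite sum_Sn_m, <- sum_n_m_S by lia. reflexivity.
Qed.

Lemma sum_n_group {G : AbelianMonoid} (f : nat -> G) (d n : nat) :
  sum_n (fun k => sum_n (fun r => f (S d * k + r)%nat) d) n
  = sum_n f (S d * n + d).
Proof.
induction n as [|n IH].
- rewrite sum_O. replace (S d * 0 + d)%nat with d by lia.
  apply sum_n_ext; intros r; f_equal; lia.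
- rewrite sum_Sn, IH. unfold sum_n.
  rewrite (sum_n_m_Chasles f 0 (S d * n + d) (S d * S n + d)) by lia.
  f_equal.
  replace (S (S d * n + d)) with (S d * S n + 0)%nat by lia.
  (* The start of the last block depends on [d], so it is freed before the induction on the block
     length. *)
  generalize (S d * S n)%nat as c; intros c. induction d as [|d IHd] in c |- *.
  + now rewrite !sum_n_n.
  + rewrite sum_n_Sm by lia. rewrite IHd, Nat.add_succ_r.
    symmetry; apply sum_n_Sm; lia.
Qed.

(** The partial sums of the grouped series are the subsequence of the original ones at the indices
    [S d * n + d]. *)
Lemma is_series_group {K : AbsRing} {V : NormedModule K} (a : nat -> V) (l : V)
    (d : nat) :
  is_series a l -> is_series (fun k => sum_n (fun r => a (S d * k + r)%nat) d) l.
Proof.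
intros H.
apply filterlim_ext with (fun n => sum_n a (S d * n + d)).
- intros n. symmetry. apply sum_n_group.
- apply filterlim_comp with (G := eventually) (2 := H).
  intros P [N HN]. exists N. intros n Hn. apply HN. nia.
Qed.

(** * Convergent series over the integers *)

(** [ZSeries] is total, so an equation about its value says nothing about convergence; this relation
    records that both halves converge, and so is stable under the operations below. *)
Definition is_ZSeries (a : Z -> C) (l : C) : Prop :=
  exists l1 l2 : C,
    is_series (fun n => a (Z.of_nat n)) l1 /\
    is_series (fun n => a (- Z.of_nat (S n))%Z) l2 /\ l = l1 + l2.

Lemma is_ZSeries_unique (a : Z -> C) (l : C) : is_ZSeries a l -> ZSeries a = l.
Proof.
intros (l1 & l2 & H1 & H2 & ->). unfold ZSeries.
now rewrite (CSeries_unique _ _ H1), (CSeries_unique _ _ H2).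
Qed.

Lemma is_ZSeries_ext (a b : Z -> C) (l : C) :
  (forall m, a m = b m) -> is_ZSeries a l -> is_ZSeries b l.
Proof.
intros E (l1 & l2 & H1 & H2 & ->). exists l1, l2. repeat split.
- now apply is_series_ext with (2 := H1).
- now apply is_series_ext with (2 := H2).
Qed.

Lemma is_ZSeries_plus (a b : Z -> C) (la lb : C) :
  is_ZSeries a la -> is_ZSeries b lb ->
  is_ZSeries (fun m => a m + b m) (la + lb).
Proof.
intros (l1 & l2 & H1 & H2 & ->) (m1 & m2 & G1 & G2 & ->).
exists (l1 + m1), (l2 + m2). repeat split.
- exact (is_series_plus _ _ _ _ H1 G1).
- exact (is_series_plus _ _ _ _ H2 G2).
- ring.
Qed.

Lemma is_ZSeries_sum_n (a : nat -> Z -> C) (l : nat -> C) (n : nat) :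
  (forall r, is_ZSeries (a r) (l r)) ->
  is_ZSeries (fun m => sum_n (fun r => a r m) n) (sum_n l n).
Proof.
intros H. induction n as [|n IH].
- rewrite sum_O. apply is_ZSeries_ext with (2 := H O).
  intros m; now rewrite sum_O.
- rewrite sum_Sn. apply is_ZSeries_ext with (2 := is_ZSeries_plus _ _ _ _ IH (H (S n))).
  intros m; now rewrite sum_Sn.
Qed.

Lemma is_ZSeries_scal (c : C) (a : Z -> C) (l : C) :
  is_ZSeries a l -> is_ZSeries (fun m => c * a m) (c * l).
Proof.
intros (l1 & l2 & H1 & H2 & ->). exists (c * l1), (c * l2). repeat split.
- exact (is_series_scal c _ _ H1).
- exact (is_series_scal c _ _ H2).
- ring.
Qed.

Lemma is_ZSeries_shift (a : Z -> C) (l : C) :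
  is_ZSeries a l -> is_ZSeries (fun m => a (m + 1)%Z) l.
Proof.
intros (l1 & l2 & H1 & H2 & ->).
(* The shift moves the term [a 0] from the nonnegative half to the negative one. *)
exists (l1 - a 0%Z), (l2 + a 0%Z). repeat split.
- apply is_series_ext with (fun n => a (Z.of_nat (S n))).
  { intros n. f_equal. lia. }
  apply (is_series_incr_1 (fun n => a (Z.of_nat n))).
  replace (plus _ _) with l1; [exact H1|].
  change (l1 = l1 - a 0%Z + a 0%Z). ring.
- apply is_series_decr_1.
  replace (plus _ _) with l2.
  + apply is_series_ext with (2 := H2). intros n. f_equal. lia.
  + change (l2 = l2 + a 0%Z - a 0%Z). ring.
- ring.
Qed.

Lemma is_ZSeries_group (a : Z -> C) (l : C) (d : nat) :
  is_ZSeries a l ->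
  is_ZSeries
    (fun m => sum_n (fun r => a (Z.of_nat (S d) * m + Z.of_nat r)%Z) d) l.
Proof.
intros (l1 & l2 & H1 & H2 & ->). exists l1, l2. repeat split.
- apply is_series_ext with (2 := is_series_group _ _ d H1).
  intros n. apply sum_n_ext; intros r. f_equal. lia.
- apply is_series_ext with (2 := is_series_group _ _ d H2).
  (* The negative half is summed downwards: [- S (S d * n + r)] has residue [d - r], so each block
     is read backwards. *)
  intros n. rewrite <- sum_n_rev.
  apply sum_n_ext_loc; intros r Hr. f_equal. nia.
Qed.

Lemma is_ZSeries_theta (z tau : C) :
  (0 < Im tau)%R -> is_ZSeries (theta_term z tau) (theta z tau).
Proof.
assert (Hex : forall u : nat -> C,
  ex_series (fun n => Cmod (u n)) -> is_series u (CSeries u)).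
{ intros u Hu.
  destruct (@ex_series_le C_AbsRing C_CompleteNormedModule u
              (fun n => Cmod (u n)) (fun n => Rle_refl _) Hu) as [l Hl].
  now rewrite (CSeries_unique _ _ Hl). }
intros Ht. destruct (theta_abs_cv z tau Ht) as [H1 H2].
exists (CSeries (fun n => theta_term z tau (Z.of_nat n))),
  (CSeries (fun n => theta_term z tau (- Z.of_nat (S n))%Z)).
repeat split; now apply Hex.
Qed.

(** * The complex exponential and roots of unity *)

Lemma Cexp_plus (a b : C) : Cexp (a + b) = Cexp a * Cexp b.
Proof.
destruct a as [a1 a2], b as [b1 b2]. unfold Cexp, Cmult; simpl.
rewrite exp_plus, cos_plus, sin_plus. apply injective_projections; simpl; ring.
Qed.

Lemma Cexp_2PI (m : Z) : Cexp (2 * PI * Ci * IZR m) = 1.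
Proof.
assert (Hn : forall n : nat, Cexp (2 * PI * Ci * IZR (Z.of_nat n)) = 1).
{ intros n. unfold Cexp.
  replace (Re _) with 0%R by (simpl; ring).
  replace (Im _) with (0 + 2 * INR n * PI)%R
    by (simpl; rewrite <- INR_IZR_INZ; ring).
  rewrite cos_period, sin_period, exp_0, cos_0, sin_0, Rmult_1_l, Rmult_0_r.
  reflexivity. }
destruct (Z_le_gt_dec 0 m) as [Hm|Hm].
- destruct (Z_of_nat_complete m Hm) as [n ->]. apply Hn.
- destruct (Z_of_nat_complete (- m)) as [n En]; [lia|].
  replace m with (- Z.of_nat n)%Z by lia.
  (* Multiplying by the value 1 at the opposite integer makes the exponent zero. *)
  rewrite <- (Cmult_1_r (Cexp _)). rewrite <- (Hn n) at 1. rewrite <- Cexp_plus.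
  rewrite opp_IZR, RtoC_opp.
  replace (_ + _) with (2 * PI * Ci * IZR (Z.of_nat 0)) by (simpl; ring).
  apply Hn.
Qed.

Lemma Cexp_period (a : C) (m : Z) : Cexp (a + 2 * PI * Ci * IZR m) = Cexp a.
Proof. now rewrite Cexp_plus, Cexp_2PI, Cmult_1_r. Qed.

Lemma Cexp_PI : Cexp (PI * Ci) = - 1.
Proof.
unfold Cexp. replace (Re _) with 0%R by (simpl; ring).
replace (Im _) with PI by (simpl; ring).
rewrite exp_0, cos_PI, sin_PI. apply injective_projections; simpl; ring.
Qed.

(** The two primitive cube roots of unity are conjugate, with real part
    [cos (2 * PI / 3) = - 1 / 2]. *)
Lemma Cexp_2PI3_sum :
  Cexp (2 * PI / 3 * Ci) + Cexp (- (2 * PI / 3 * Ci)) = - 1.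
Proof.
replace (2 * PI / 3) with (RtoC (2 * (PI / 3))) by
  (unfold Rdiv; rewrite !RtoC_mult, RtoC_inv by lra; field).
unfold Cexp.
replace (Re (RtoC (2 * (PI / 3)) * Ci)) with 0%R by (simpl; ring).
replace (Re (- (RtoC (2 * (PI / 3)) * Ci))) with 0%R by (simpl; ring).
replace (Im (RtoC (2 * (PI / 3)) * Ci)) with (2 * (PI / 3))%R by (simpl; ring).
replace (Im (- (RtoC (2 * (PI / 3)) * Ci))) with (- (2 * (PI / 3)))%R
  by (simpl; ring).
rewrite exp_0, cos_neg, sin_neg, cos_2PI3.
apply injective_projections; simpl; field.
Qed.

(** * Periodicity and multisection of theta *)

Lemma theta_period (z tau : C) (m : Z) : theta (z + IZR m) tau = theta z tau.
Proof.
unfold theta, ZSeries, CSeries.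
assert (E : forall k, theta_term (z + IZR m) tau k = theta_term z tau k).
{ intros k. unfold theta_term. f_equal.
  rewrite <- (Cexp_period (_ * z) (k * m)). f_equal. rewrite mult_IZR, RtoC_mult. ring. }
f_equal; f_equal; apply Series_ext; intros n; now rewrite E.
Qed.

(** Shift the summation index by one: [(m+1)^2 tau + 2 (m+1) z = m^2 tau + 2 m (z + tau) + tau + 2
    z]. *)
Lemma theta_quasi_period (z tau : C) : (0 < Im tau)%R ->
  theta z tau = Cexp (PI * Ci * tau + 2 * PI * Ci * z) * theta (z + tau) tau.
Proof.
intros Ht.
rewrite <- (is_ZSeries_unique _ _ (is_ZSeries_shift _ _ (is_ZSeries_theta z tau Ht))).
apply is_ZSeries_unique.
apply is_ZSeries_ext
  with (2 := is_ZSeries_scal _ _ _ (is_ZSeries_theta (z + tau) tau Ht)).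
intros m. unfold theta_term. rewrite <- !Cexp_plus. f_equal.
rewrite plus_IZR, RtoC_plus. ring.
Qed.

Lemma theta_multisection (d : nat) (z tau : C) : (0 < Im tau)%R ->
  theta z tau
  = sum_n (fun r =>
      Cexp (PI * Ci * INR r ^ 2 * tau + 2 * PI * Ci * INR r * z)
      * theta (INR (S d) * (z + INR r * tau)) (INR (S d) ^ 2 * tau)) d.
Proof.
intros Ht. set (D := INR (S d)).
assert (HD : (0 < Im (D ^ 2 * tau))%R).
{ rewrite <- RtoC_pow, im_scal_l.
  apply Rmult_lt_0_compat; [apply pow_lt, lt_0_INR; lia | assumption]. }
rewrite <- (is_ZSeries_unique _ _ (is_ZSeries_group _ _ d (is_ZSeries_theta z tau Ht))).
apply is_ZSeries_unique.
apply is_ZSeries_ext with (2 := is_ZSeries_sum_n _ _ d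
  (fun r => is_ZSeries_scal _ _ _ (is_ZSeries_theta (D * (z + INR r * tau)) _ HD))).
(* With [k = D m + r], [k^2 tau + 2 k z = m^2 D^2 tau + 2 m D (z + r tau) + r^2 tau + 2 r z]. *)
intros m. apply sum_n_ext; intros r.
unfold theta_term. rewrite <- !Cexp_plus. f_equal.
rewrite plus_IZR, mult_IZR, <- !INR_IZR_INZ, RtoC_plus, RtoC_mult.
fold D. ring.
Qed.

(** The half-period added to [z / 2] gives the odd residue class the sign [Cexp (PI * Ci) = - 1]. *)
Lemma theta_bisection (z tau : C) : (0 < Im tau)%R ->
  theta ((z + 1) / 2) (tau / 4)
  = theta z tau - Cexp (PI * Ci * (tau / 4 + z)) * theta (z + tau / 2) tau.
Proof.
intros Ht.
assert (Ht4 : (0 < Im (tau / 4))%R).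
{ unfold Cdiv. rewrite <- RtoC_inv, im_scal_r; lra. }
rewrite (theta_multisection 1 _ _ Ht4), sum_Sn, sum_O.
change plus with Cplus. simpl INR. rewrite RtoC_plus.
replace (PI * Ci * 0 ^ 2 * (tau / 4) + 2 * PI * Ci * 0 * ((z + 1) / 2))
  with (2 * PI * Ci * IZR 0) by (simpl; field).
rewrite Cexp_2PI, Cmult_1_l.
replace ((1 + 1) ^ 2 * (tau / 4)) with tau by field.
replace ((1 + 1) * ((z + 1) / 2 + 0 * (tau / 4))) with (z + IZR 1) by field.
replace ((1 + 1) * ((z + 1) / 2 + 1 * (tau / 4))) with (z + tau / 2 + IZR 1)
  by field.
rewrite !theta_period.
replace (PI * Ci * 1 ^ 2 * (tau / 4) + 2 * PI * Ci * 1 * ((z + 1) / 2))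
  with (PI * Ci + PI * Ci * (tau / 4 + z)) by field.
rewrite Cexp_plus, Cexp_PI. ring.
Qed.

Lemma theta_trisection (z tau : C) (j : Z) : (0 < Im tau)%R ->
  theta ((z + IZR j) / 3) (tau / 9)
  = theta z tau
    + Cexp (2 * PI / 3 * Ci * IZR j)
      * (Cexp (PI * Ci / 3 * (tau / 3 + 2 * z)) * theta (z + tau / 3) tau)
    + Cexp (- (2 * PI / 3 * Ci * IZR j))
      * (Cexp (PI * Ci / 3 * (tau / 3 - 2 * z)) * theta (z - tau / 3) tau).
Proof.
intros Ht.
assert (Ht9 : (0 < Im (tau / 9))%R).
{ unfold Cdiv. rewrite <- RtoC_inv, im_scal_r; lra. }
rewrite (theta_multisection 2 _ _ Ht9), !sum_Sn, sum_O.
change plus with Cplus. simpl INR. rewrite !RtoC_plus.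
replace (PI * Ci * 0 ^ 2 * (tau / 9) + 2 * PI * Ci * 0 * ((z + IZR j) / 3))
  with (2 * PI * Ci * IZR 0) by (simpl; field).
rewrite Cexp_2PI, Cmult_1_l.
replace ((1 + 1 + 1) ^ 2 * (tau / 9)) with tau by field.
replace ((1 + 1 + 1) * ((z + IZR j) / 3 + 0 * (tau / 9))) with (z + IZR j) by field.
replace ((1 + 1 + 1) * ((z + IZR j) / 3 + 1 * (tau / 9)))
  with (z + tau / 3 + IZR j) by field.
(* Writing the shift [2 tau / 3] as [- tau / 3 + tau] prepares for quasi-periodicity. *)
replace ((1 + 1 + 1) * ((z + IZR j) / 3 + (1 + 1) * (tau / 9)))
  with (z - tau / 3 + tau + IZR j) by field.
rewrite !theta_period, (theta_quasi_period (z - tau / 3) tau Ht).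
rewrite !Cmult_assoc, <- !Cexp_plus.
f_equal; [f_equal|]; f_equal.
- f_equal. field.
(* Residue 2 carries the phase [4 PI j / 3], which differs from [- 2 PI j / 3] by [2 PI j]. *)
- rewrite <- (Cexp_period (_ + _ + _) j). f_equal. field.
Qed.

Theorem lemma5 : forall (f : UHP -> UHP) (tau : UHP) (x : C),
  (2 * theta ((f tau - tau) / 4 + x) tau
   - 2 * theta ((f tau - tau) / 8 + (x + 1) / 2) (tau / 4)
   = Cexp (PI * Ci * (f tau / 4 + x)) * theta ((f tau + tau) / 4 + x) tau
     + Cexp (PI * Ci * ((2 * tau - f tau) / 4 - x))
       * theta ((f tau - 3 * tau) / 4 + x) tau)
  /\
  (2 * sqrt 3 / (1 + sqrt 3) * theta ((f tau - tau) / 6 + x) tau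
   - sqrt 3
     * (Cexp (PI * Ci / 3 * (f tau / 3 + 2 * x))
          * theta ((f tau + tau) / 6 + x) tau
        + Cexp (PI * Ci / 3 * ((2 * tau - f tau) / 3 - 2 * x))
          * theta ((f tau - 3 * tau) / 6 + x) tau)
   = theta ((f tau - tau) / 18 + (x + 1) / 3) (tau / 9)
     + theta ((f tau - tau) / 18 + (x - 1) / 3) (tau / 9)
     - 2 / (1 + sqrt 3) * theta ((f tau - tau) / 18 + x / 3) (tau / 9)).
Proof.
intros f [tau Ht] x. simpl UHP_val. generalize (UHP_val (f (exist _ tau Ht))).
intros w. split.
(* In terms of this [z] the theta arguments are [z], [(z + 1) / 2] and [z + tau / 2],
   [z - tau / 2]. *)
- set (z := (w - tau) / 4 + x).
  replace ((w - tau) / 8 + (x + 1) / 2) with ((z + 1) / 2) by (unfold z; field).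
  replace ((w + tau) / 4 + x) with (z + tau / 2) by (unfold z; field).
  replace ((w - 3 * tau) / 4 + x) with (z - tau / 2) by (unfold z; field).
  replace (w / 4 + x) with (tau / 4 + z) by (unfold z; field).
  replace ((2 * tau - w) / 4 - x) with (tau / 4 - z) by (unfold z; field).
  (* Bisection turns the left side into twice the first term on the right; quasi-periodicity makes
     the two right-hand terms equal. *)
  rewrite (theta_bisection z tau Ht), (theta_quasi_period (z - tau / 2) tau Ht).
  rewrite Cmult_assoc, <- Cexp_plus.
  replace (z - tau / 2 + tau) with (z + tau / 2) by field.
  replace (PI * Ci * (tau / 4 - z) + (PI * Ci * tau + 2 * PI * Ci * (z - tau / 2)))
    with (PI * Ci * (tau / 4 + z)) by field.
  ring.
- set (z := (w - tau) / 6 + x).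
  replace ((w - tau) / 18 + (x + 1) / 3) with ((z + IZR 1) / 3)
    by (unfold z; field).
  replace ((w - tau) / 18 + (x - 1) / 3) with ((z + IZR (-1)) / 3)
    by (unfold z; field).
  replace ((w - tau) / 18 + x / 3) with ((z + IZR 0) / 3) by (unfold z; field).
  replace ((w + tau) / 6 + x) with (z + tau / 3) by (unfold z; field).
  replace ((w - 3 * tau) / 6 + x) with (z - tau / 3) by (unfold z; field).
  replace (w / 3 + 2 * x) with (tau / 3 + 2 * z) by (unfold z; field).
  replace ((2 * tau - w) / 3 - 2 * x) with (tau / 3 - 2 * z) by (unfold z; field).
  rewrite !(theta_trisection z tau _ Ht).
  replace (2 * PI / 3 * Ci * IZR 1) with (2 * PI / 3 * Ci) by field.
  replace (2 * PI / 3 * Ci * IZR (-1)) with (- (2 * PI / 3 * Ci)) by field.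
  replace (- - (2 * PI / 3 * Ci)) with (2 * PI / 3 * Ci) by field.
  replace (- (2 * PI / 3 * Ci * IZR 0)) with (2 * PI * Ci * IZR 0) by field.
  replace (2 * PI / 3 * Ci * IZR 0) with (2 * PI * Ci * IZR 0) by field.
  rewrite Cexp_2PI.
  assert (Hw := Cexp_2PI3_sum).
  (* Let [A], [B], [C] be the three terms of the trisection at [j = 0]. Since [u + v = - 1], the
     right side of (2) is [2 A - (B + C) - 2 / (1 + s) * (A + B + C)] with [s = sqrt 3]. *)
  set (u := Cexp (2 * PI / 3 * Ci)) in *.
  set (v := Cexp (- (2 * PI / 3 * Ci))) in *.
  replace v with (- 1 - u) by (rewrite <- Hw; ring).
  assert (Hs : RtoC (sqrt 3) * sqrt 3 = 3)
    by (rewrite <- RtoC_mult, sqrt_sqrt by lra; reflexivity).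
  assert (Hn : 1 + RtoC (sqrt 3) <> 0).
  { rewrite <- RtoC_plus. intros H. apply (f_equal Re) in H. simpl in H.
    assert (H3 := sqrt_pos 3). lra. }
  set (s := RtoC (sqrt 3)) in *.
  (* The coefficients of [B + C] agree because [s * (1 + s) = 3 + s]; writing 3 as [s * s] leaves a
     ring identity. *)
  field_simplify_eq; [|assumption]. cbv beta. rewrite <- Hs. ring.
Qed.
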